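(* Consider the Reverse Homogeneous Firework Process with radii distributed as an $\mathbb{N}$-valued random variable $R$ with $\mathbb{P}(R<1)\in(0,1)$, and let $S$ be the event that the process survives. (I) If $\mathbb{E}(R)=\infty$ then $\mathbb{P}(S)=1$. (II) If $\mathbb{E}(R)<\infty$ then $\mathbb{P}(S)=0$.
   Context: $\mathbb{N}=\{0,1,2,\dots\}$. Reverse Homogeneous Firework Process: let $(R_i)_{i\in\mathbb{N}}$ be independent, identically distributed random variables with values in $\mathbb{N}$, with common distribution that of $R$; it is assumed throughout that $\mathbb{P}(R<1)\in(0,1)$. The vertices are the points $i\in\mathbb{N}$. At time $0$ only the origin is activated. At time $1$ all vertices $i\geq 1$ with $i\le R_i$ are activated. In general, at each discrete time $t\ge 1$, the vertices $j$ for which there is a vertex $i$ activated at time $t-1$ lying to the left of $j$ within distance $R_j$ (that is, $j-R_j\le i<j$) are activated. The process survives (event $S$) if infinitely many vertices are activated in the course of time. *)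

(* Defs.v *)
From HB Require Import structures.
From mathcomp Require Import all_boot all_order all_algebra.
From mathcomp Require Import all_classical all_reals all_analysis.

Set Implicit Arguments.
Unset Strict Implicit.
Unset Printing Implicit Defensive.

Import Order.TTheory GRing.Theory Num.Theory.
Import numFieldNormedType.Exports.

Local Open Scope classical_set_scope.
Local Open Scope ring_scope.

(* Mutual independence: a duplicate-free sequence [J] plays the role of a
   finite set of indices. *)
Definition mutually_independent (d d' : measure_display)
    (T : measurableType d) (T' : measurableType d') (R : realType)
    (P : probability T R) (I : choiceType) (X : I -> {RV P >-> T'}) : Prop :=
  forall (J : seq I) (A : I -> set T'),
    uniq J -> (forall i, measurable (A i)) ->
    P (\bigcap_(i in [set` J]) (X i @^-1` A i)) =
    (\prod_(i <- J) P (X i @^-1` A i))%E.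

Definition identically_distributed_as (d d' : measure_display)
    (T : measurableType d) (T' : measurableType d') (R : realType)
    (P : probability T R) (I : Type) (X : I -> {RV P >-> T'})
    (Y : {RV P >-> T'}) : Prop :=
  forall (i : I) (A : set T'), measurable A ->
    distribution P (X i) A = distribution P Y A.

(* For fixed radii [r], the set of vertices activated at time [t].  The
   subtraction is truncated, which is harmless because [0 <= i].  A vertex may
   be activated at several times; ignoring reactivations would not change the
   union over [t]. *)
Fixpoint activated (r : nat -> nat) (t : nat) : set nat :=
  if t is t'.+1 then
    [set j | exists2 i, activated r t' i & (j - r j <= i < j)%N]
  else [set 0%N].

Definition ever_activated (r : nat -> nat) : set nat :=
  \bigcup_t activated r t.

Definition survival (T : Type) (X : nat -> T -> nat) : set T :=
  [set w | infinite_set (ever_activated (X ^~ w))].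

Lemma measurable_survival (d : measure_display) (T : measurableType d)
    (X : nat -> {mfun T >-> nat}) : measurable (survival (fun i => X i)).
Proof.
have mact t j : measurable [set w | activated (fun i => X i w) t j].
  elim: t j => [|t IH] j /=.
    by have [->|j0] := eqVneq j 0%N;
      [rewrite (_ : mkset _ = setT) // | rewrite (_ : mkset _ = set0) //];
      apply/seteqP; split => // w /eqP; rewrite (negbTE j0).
  rewrite (_ : mkset _ = \bigcup_i
      ([set w | activated (fun k => X k w) t i] `&`
       (X j @^-1` [set m | (j - m <= i < j)%N]))); last first.
    apply/seteqP; split => w /=.
      by move=> [i h1 h2]; exists i.
    by move=> [i _ [h1 h2]]; exists i.
  apply: bigcup_measurable => i _; apply: measurableI; first exact: IH.
  by rewrite -[X in measurable X]setTI; apply: measurable_funP.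
rewrite (_ : survival _ = \bigcap_n \bigcup_(j in [set j | (n <= j)%N])
    \bigcup_t [set w | activated (fun i => X i w) t j]).
  apply: bigcap_measurable => // n _; apply: bigcup_measurable => j _.
  by apply: bigcup_measurable => t _; exact: mact.
apply/seteqP; split => w /=.
  move=> winf n _; apply: contrapT => h; apply: winf.
  apply: (sub_finite_set _ (finite_II n)) => j [t _ tj] /=.
  by rewrite ltnNge; apply/negP => nj; apply: h; exists j => //; exists t.
move=> h /finite_seqP[F FE].
have [j nj [t _ tj]] := h (\max_(i <- F) i).+1 I.
have : ever_activated (X ^~ w) j by exists t.
rewrite FE /= => jF.
by move: nj => /=; rewrite ltnNge (@leq_bigmax_seq _ F xpredT id j).
Qed.

(* Main.v *)
Require Import Defs.
From HB Require Import structures.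
From mathcomp Require Import all_boot all_order all_algebra.
From mathcomp Require Import all_classical all_reals all_analysis.
From mathcomp Require Import measurable_realfun.
From mathcomp Require Import zify ring lra.

Set Implicit Arguments.
Unset Strict Implicit.
Unset Printing Implicit Defensive.

Import Order.TTheory GRing.Theory Num.Theory.
Import numFieldNormedType.Exports.

Local Open Scope classical_set_scope.
Local Open Scope ring_scope.
Local Open Scope ereal_scope.

(** Write [a k] for the probability that a radius exceeds [k]; the expected
    radius is the sum of the [a k] ([expectation_tail_prob]).  Both halves of
    the dichotomy reduce survival to independent events whose probabilities
    are controlled by that sum.

    If the sum diverges, consider the events that vertex [k.+1] has radius
    greater than [k].  Such a vertex reaches the origin, hence is activated at
    time 1.  These events are independent, so the probability that none of
    them occurs for [n <= k < N] is the product of the [1 - a k], at most the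
    exponential of minus a sum that tends to infinity with [N]
    ([prob_no_long_radius]).  Almost surely infinitely many of them occur: this
    is the second Borel-Cantelli lemma.

    If the sum is a finite [s], call a point [n > 0] a cut when no vertex
    [n + k] has a radius greater than [k].  Nothing at or beyond a cut can be
    activated, because no vertex there sees a vertex left of the cut
    ([cut_bounds_activated]); one cut therefore forbids survival.  The point
    [n] is a cut with probability the infinite product of the [1 - a k], which
    is at least [q = expR (- (s / (1 - a 0))) > 0]; this is where [a 0 < 1],
    that is, a positive probability of radius 0, matters.  The cut events at
    different points are dependent, but they become independent for the points
    [M], [2M], ..., [KM] once only the [M] vertices starting at each point are
    inspected; the price is an error of at most the tail of the sum from [M]
    on for each point.  Hence survival has probability at most
    [(1 - q) ^+ K + K * (tail from M)] (see [prob_survival_le]).  Letting first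
    [M] and then [K] tend to infinity gives 0. *)

(** * Deterministic facts about the activated set *)

Lemma long_radius_activated (r : nat -> nat) j :
  (0 < j <= r j)%N -> ever_activated r j.
Proof.
move=> jr; exists 1%N => //=; exists 0%N => //.
lia.
Qed.

(** By induction on time: a vertex at or beyond [n] can only be activated by a
    vertex at or beyond [n], and the origin is not one. *)
Lemma cut_bounds_activated (r : nat -> nat) n : (0 < n)%N ->
  (forall k, (r (n + k) <= k)%N) -> ever_activated r `<=` `I_n.
Proof.
move=> n0 cut j [t _]; elim: t j => [|t IH] j /=; first by move=> ->.
move=> [i /IH/= in_ /andP[jri _]]; rewrite ltnNge; apply/negP => nj.
by have := cut (j - n)%N; rewrite subnKC //; lia.
Qed.

(** * Comparing products with exponentials of sums *)

Section real_products.
Context {R : realType}.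

Lemma prod_1B_le_expR (I : Type) (J : seq I) (u : I -> R) :
  (forall i, 0 <= u i <= 1)%R ->
  (\prod_(i <- J) (1 - u i) <= expR (- \sum_(i <- J) u i))%R.
Proof.
move=> u01; rewrite -sumrN expR_sum; apply: ler_prod => i _.
by have := expR_ge1Dx (- u i); have := u01 i; lra.
Qed.

(** Each factor obeys [(1 - u)^-1 = 1 + u / (1 - u) <= expR (u / (1 - a))], so
    that a bound on the sum of the [u i] keeps the product away from 0. *)
Lemma expR_le_prod_1B (I : Type) (J : seq I) (u : I -> R) a : (a < 1)%R ->
  (forall i, 0 <= u i <= a)%R ->
  (expR (- ((\sum_(i <- J) u i) / (1 - a))) <= \prod_(i <- J) (1 - u i))%R.
Proof.
move=> a1 ua; rewrite mulr_suml -sumrN expR_sum; apply: ler_prod => i _.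
rewrite expR_ge0 /= expRN invf_ple ?posrE ?expR_gt0 //; last first.
  by have := ua i; lra.
apply: le_trans (expR_ge1Dx _).
have /andP[u0 ua'] := ua i.
have h : (0 < 1 - u i)%R by lra.
rewrite (_ : (1 - u i)^-1 = 1 + u i / (1 - u i))%R; last by field; lra.
by rewrite lerD2l ler_wpM2l // lef_pV2 ?posrE; lra.
Qed.

End real_products.

(** * Independent events *)

Section independence.
Context d (T : measurableType d) (R : realType) (P : probability T R).

(** Complementing the events one at a time requires the product rule for mixed
    families, some events complemented and some not; the step is
    [P (D `\` E i) = P D - P (D `&` E i)]. *)
Lemma prob_bigcap_setC (I : choiceType) (E : I -> set T) :
  (forall i, measurable (E i)) ->
  (forall J : seq I, uniq J ->
    P (\bigcap_(i in [set` J]) E i) = \prod_(i <- J) P (E i)) ->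
  forall J : seq I, uniq J ->
    P (\bigcap_(i in [set` J]) ~` E i) = \prod_(i <- J) (1 - P (E i)).
Proof.
move=> mE hE.
have fin (J : seq I) (F : I -> \bar R) : (forall i, F i \is a fin_num) ->
    \prod_(i <- J) F i \is a fin_num.
  by move=> hF; elim/big_ind : _ => // *; rewrite fin_numM.
suff H (J K : seq I) : uniq (J ++ K) ->
    P (\bigcap_(i in [set` J]) ~` E i `&` \bigcap_(i in [set` K]) E i) =
    \prod_(i <- J) (1 - P (E i)) * \prod_(i <- K) P (E i).
  move=> J uJ; have := H J [::]; rewrite cats0 => /(_ uJ).
  by rewrite !bigcap_seq !big_nil setIT mule1.
elim: J K => [|i J IH] K.
  by move=> uK; rewrite big_nil mul1e -hE // bigcap_seq big_nil setTI.
move=> /= /andP[iJK uJK].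
have H1 := IH K uJK.
have /IH H2 : uniq (J ++ i :: K).
  by rewrite -(@perm_uniq _ (i :: J ++ K)) /= ?iJK // -cat1s perm_catCA.
have mJK : measurable
    (\bigcap_(i in [set` J]) ~` E i `&` \bigcap_(i in [set` K]) E i).
  apply: measurableI; apply: fin_bigcap_measurable => //= k _.
  exact: measurableC.
transitivity (P ((\bigcap_(i in [set` J]) ~` E i `&`
    \bigcap_(i in [set` K]) E i) `\` E i)).
  by congr (P _); rewrite !bigcap_seq big_cons setDE -setIA setIC.
rewrite (_ : P (_ `\` _) = P (\bigcap_(i in [set` J]) ~` E i `&`
      \bigcap_(i in [set` K]) E i) -
    P (\bigcap_(i in [set` J]) ~` E i `&`
      \bigcap_(k in [set` i :: K]) E k)); last first.
  rewrite (_ : _ `&` \bigcap_(k in [set` i :: K]) E k =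
      (\bigcap_(i in [set` J]) ~` E i `&` \bigcap_(i in [set` K]) E i) `&` E i).
    by apply: measureD => //; rewrite ltey_eq fin_num_measure.
  by rewrite !bigcap_seq big_cons -setIA (setIC (E i)).
rewrite H1 H2 !big_cons -muleA muleBl.
- by rewrite mul1e muleCA.
- by rewrite fin_numM // fin // => j; rewrite ?fin_numB ?fin_num_measure.
- by rewrite fin_num_adde_defl // fin_numN fin_num_measure.
Qed.

(** Grouping independent variables into disjoint blocks, the [j]-th block being
    [h j k] for [k] in [t], yields independent events; injectivity of [h] is
    the disjointness of the blocks. *)
Lemma prob_bigcap_blocks d' (T' : measurableType d') (I J K : choiceType)
    (X : I -> {RV P >-> T'}) (A : I -> set T') (h : J -> K -> I)
    (s : seq J) (t : seq K) :
  mutually_independent X -> (forall i, measurable (A i)) ->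
  uniq s -> uniq t ->
  {in [seq (j, k) | j <- s, k <- t] &, injective (uncurry h)} ->
  P (\bigcap_(j in [set` s]) \bigcap_(k in [set` t])
    (X (h j k) @^-1` A (h j k))) =
  \prod_(j <- s) \prod_(k <- t) P (X (h j k) @^-1` A (h j k)).
Proof.
move=> indep mA us ut hinj.
have /(indep _ _)/(_ mA) := allpairs_uniq us ut hinj.
rewrite big_allpairs_dep => <-; congr (P _).
rewrite !bigcap_seq big_allpairs_dep; apply: eq_bigr => j _.
by rewrite bigcap_seq.
Qed.

End independence.

(** * Tail probabilities of a random variable with values in nat *)

Lemma measurable_preimage_nat d (T : measurableType d) (X : {mfun T >-> nat})
  (A : set nat) : measurable (X @^-1` A).
Proof. exact: measurable_funPTI. Qed.

Lemma measurable_gt_nat d (T : measurableType d) (X : {mfun T >-> nat}) k :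
  measurable [set w | (k < X w)%N].
Proof. exact: (measurable_preimage_nat X [set m | (k < m)%N]). Qed.

Section tail_probabilities.
Context d (T : measurableType d) (R : realType) (P : probability T R).
Implicit Types Y : {RV P >-> nat}.

(** Real-valued, so that the estimates on products take place in [R]. *)
Definition tail_prob Y (k : nat) : R := fine (P [set w | (k < Y w)%N]).

Lemma EFin_tail_prob Y k : (tail_prob Y k)%:E = P [set w | (k < Y w)%N].
Proof. by rewrite fineK // fin_num_measure //; exact: measurable_gt_nat. Qed.

Lemma tail_prob_itv Y k : (0 <= tail_prob Y k <= tail_prob Y 0)%R.
Proof.
have mY := @measurable_gt_nat _ _ Y.
rewrite fine_ge0 //= fine_le ?fin_num_measure // le_measure ?inE //.
by move=> w /=; lia.
Qed.

Lemma tail_prob_le1 Y k : (tail_prob Y k <= 1)%R.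
Proof.
by rewrite -lee_fin EFin_tail_prob probability_le1 //; exact: measurable_gt_nat.
Qed.

(** A natural number [Y w] is the number of [k] with [k < Y w]; the expectation
    of this sum of indicators is taken term by term. *)
Lemma expectation_tail_prob Y :
  'E_P[fun w => (Y w)%:R] = \sum_(0 <= k <oo) (tail_prob Y k)%:E.
Proof.
have mY := @measurable_gt_nat _ _ Y.
rewrite unlock.
transitivity (\int[P]_w \sum_(0 <= k <oo) (\1_[set w | (k < Y w)%N] w)%:E).
  apply: eq_integral => w _.
  rewrite (nneseries_split 0 (Y w)) //.
  rewrite add0n eseries0 ?adde0; last first.
    by move=> k Yk _; rewrite indicE memNset //=; lia.
  rewrite (eq_big_nat _ _ (F2 := fun=> 1%:E)); last first.
    by move=> k /andP[_ kY]; rewrite indicE mem_set.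
  by rewrite sumEFin sumr_const_nat subn0.
rewrite integral_nneseries //; last first.
  by move=> k; apply/measurable_EFinP; exact: measurable_indic.
by apply: eq_eseriesr => k _; rewrite integral_indic // setIT EFin_tail_prob.
Qed.

End tail_probabilities.

(** * The reverse firework process *)

Section reverse_firework.
Context d (T : measurableType d) (R : realType) (P : probability T R).
Context (rho : {RV P >-> nat}) (X : nat -> {RV P >-> nat})
  (indepX : mutually_independent X)
  (distX : identically_distributed_as X rho).
Local Notation a := (tail_prob rho).

Lemma prob_radius_gt i k : P [set w | (k < X i w)%N] = (a k)%:E.
Proof. by rewrite EFin_tail_prob; exact: (@distX i [set m | (k < m)%N]). Qed.

Lemma prob_radius_le i k : P (X i @^-1` [set m | (m <= k)%N]) = (1 - a k)%:E.
Proof.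
rewrite (_ : _ @^-1` _ = ~` [set w | (k < X i w)%N]).
  by rewrite probability_setC ?prob_radius_gt //; exact: measurable_gt_nat.
by apply/seteqP; split=> w /=; [move=> h | move/negP]; lia.
Qed.

(** Were the probability some [c > 0], the bound
    [c <= expR (- \sum_(n <= k < N) a k)], valid for every [N], would make the
    partial sums of [a] bounded by [n - ln c]. *)
Lemma prob_no_long_radius n : \sum_(0 <= k <oo) (a k)%:E = +oo ->
  P (\bigcap_(k in [set k | (n <= k)%N])
    (X k.+1 @^-1` [set m | (m <= k)%N])) = 0.
Proof.
move=> aoo.
set G := \bigcap_(k in _) _.
have mG : measurable G.
  apply: bigcap_measurable => [|k _]; first by exists n => /=.
  exact: measurable_preimage_nat.
have le_exp N : (P G <= (expR (- \sum_(n <= k < N) a k))%:E).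
  set H := \bigcap_(j in [set` map S (index_iota n N)])
    (X j @^-1` [set m | (m < j)%N]).
  apply: (@le_trans _ _ (P H)).
    apply: le_measure; rewrite ?inE //.
      by apply: fin_bigcap_measurable => // j _; exact: measurable_preimage_nat.
    move=> w Gw _ /mapP[k + ->] /=; rewrite mem_index_iota => /andP[nk _].
    exact: (Gw k).
  rewrite /H indepX //; last first.
    by rewrite map_inj_uniq ?iota_uniq //; exact: succn_inj.
  rewrite big_map (eq_bigr (fun k => (1 - a k)%:E)); last first.
    by move=> k _; exact: prob_radius_le.
  rewrite prodEFin lee_fin; apply: prod_1B_le_expR => k.
  by rewrite tail_prob_le1 andbT; have /andP[] := tail_prob_itv rho k.
have G_fin : P G \is a fin_num by rewrite fin_num_measure.
apply/eqP; rewrite eq_le measure_ge0 andbT; apply: contra_eqT aoo.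
rewrite -ltNge -(fineK G_fin) lte_fin => G0.
rewrite -ltey; set c := fine (P G) in G0 *.
apply: (@le_lt_trans _ _ (n%:R - ln c)%:E); last exact: ltry.
apply: lime_le.
  by apply: is_cvg_nneseries => k _ _; have /andP[] := tail_prob_itv rho k.
near=> N.
have nN : (n <= N)%N by near: N; exists n.
rewrite sumEFin lee_fin (big_cat_nat (n := n)) //= lerD //.
  rewrite -[leRHS](_ : \sum_(0 <= k < n) 1 = _)%R; last first.
    by rewrite sumr_const_nat subn0.
  by apply: ler_sum => k _; exact: tail_prob_le1.
rewrite lerNr -ler_expR lnK ?posrE //.
by rewrite -lee_fin fineK.
Unshelve. all: by end_near. Qed.

Lemma survival_of_infinite_mean : \sum_(0 <= k <oo) (a k)%:E = +oo ->
  P (survival (fun i => X i)) = 1.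
Proof.
move=> aoo; have mS := measurable_survival X.
rewrite -[survival _]setCK probability_setC ?sube0; last exact: measurableC.
rewrite (_ : P _ = 0) ?sube0 //.
apply/negligibleP; first exact: measurableC.
apply: (@negligibleS _ _ _ P (\bigcup_n
   \bigcap_(k in [set k | (n <= k)%N]) (X k.+1 @^-1` [set m | (m <= k)%N]))).
  move=> w /= /contrapT fin.
  have /finite_seqP[F FE] := fin.
  exists (\max_(i <- F) i)%N => // k /= Fk.
  rewrite leqNgt; apply/negP => kX.
  have : ever_activated (fun i => X i w) k.+1.
    by apply: long_radius_activated.
  rewrite FE => /= kF.
  have := @leq_bigmax_seq _ F xpredT id k.+1 kF isT.
  by rewrite /= leqNgt ltnS Fk.
apply: negligible_bigcup => n; apply/negligibleP; last first.
  exact: prob_no_long_radius.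
apply: bigcap_measurable => [|k _]; first by exists n => /=.
exact: measurable_preimage_nat.
Qed.

(** The event that [n = i.+1 * M] looks like a cut when only the vertices from
    [n] to [n + M - 1] are inspected.  Blocks start at [M] and not at 0, because
    the origin is active and a cut has to lie to its right. *)
Definition cut_block M i : set T :=
  \bigcap_(k in [set` iota 0 M]) (X (i.+1 * M + k) @^-1` [set m | (m <= k)%N]).

Lemma measurable_cut_block M i : measurable (cut_block M i).
Proof.
by apply: fin_bigcap_measurable => // k _; exact: measurable_preimage_nat.
Qed.

Lemma prob_bigcap_cut_block M (J : seq nat) : uniq J ->
  P (\bigcap_(i in [set` J]) cut_block M i) =
  \prod_(i <- J) (\prod_(0 <= k < M) (1 - a k))%:E.
Proof.
move=> uJ.
(* The condition on vertex [n] of a block depends only on its offset from the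
   start of the block, which is a multiple of [M]. *)
pose A n := [set m | (m <= n %% M)%N].
have modE i k : (k < M)%N -> ((i.+1 * M + k) %% M = k)%N.
  by move=> kM; rewrite modnMDl modn_small.
have inj : {in [seq (i, k) | i <- J, k <- iota 0 M] &,
    injective (uncurry (fun i k => (i.+1 * M + k)%N))}.
  move=> _ _ /allpairsP[[i k] [_ + ->]] /allpairsP[[i' k'] [_ + ->]] /=.
  rewrite !mem_iota /= => kM k'M eq_ik.
  have kk : k = k' by rewrite -(modE i k) // eq_ik modE.
  move: eq_ik; rewrite kk => /addIn/eqP; rewrite eqn_pmul2r; last by lia.
  by move=> /eqP[->].
transitivity (P (\bigcap_(i in [set` J]) \bigcap_(k in [set` iota 0 M])
    (X (i.+1 * M + k) @^-1` A (i.+1 * M + k)%N))).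
  congr (P _); apply: eq_bigcapr => i _; apply: eq_bigcapr => k /=.
  by rewrite mem_iota /= => kM; rewrite /A modE.
rewrite (prob_bigcap_blocks indepX _ uJ (iota_uniq 0 M) inj) //.
apply: eq_bigr => i _; rewrite -prodEFin /index_iota subn0.
rewrite big_seq [RHS]big_seq; apply: eq_bigr => k.
by rewrite mem_iota /= => kM; rewrite /A modE // prob_radius_le.
Qed.

Lemma prob_no_cut_block M K :
  P (\bigcap_(i in [set` iota 0 K]) ~` cut_block M i) =
  ((1 - \prod_(0 <= k < M) (1 - a k)) ^+ K)%:E.
Proof.
have PE i : P (cut_block M i) = (\prod_(0 <= k < M) (1 - a k))%:E.
  rewrite -[LHS](_ : P (\bigcap_(i in [set` [:: i]]) cut_block M i) = _).
    by rewrite prob_bigcap_cut_block // big_seq1.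
  by rewrite bigcap_seq big_seq1.
rewrite prob_bigcap_setC ?iota_uniq //.
- rewrite (eq_bigr (fun=> (1 - \prod_(0 <= k < M) (1 - a k))%:E)).
    rewrite prodEFin -/(index_iota 0 K) big_const_seq.
    by rewrite count_predT size_iota iter_mulr_1.
  by move=> i _; rewrite EFinB; congr (_ - _); exact: PE.
- exact: measurable_cut_block.
- move=> J uJ; rewrite prob_bigcap_cut_block //.
  by apply: eq_bigr => i _; rewrite PE.
Qed.

(** If the process survives, none of the points [M], ..., [KM] is a cut: either
    no block looks like a cut, or some point [i.+1 * M] is reached over by a
    vertex at distance [k >= M] from it. *)
Lemma prob_survival_le M K : (0 < M)%N ->
  P (survival (fun i => X i)) <=
  ((1 - \prod_(0 <= k < M) (1 - a k)) ^+ K)%:E +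
  K%:R%:E * \sum_(M <= k <oo) (a k)%:E.
Proof.
move=> M0.
pose C i := \bigcup_(k in ~` `I_M) [set w | (k < X (i.+1 * M + k)%N w)%N].
have mC i : measurable (C i).
  by apply: bigcup_measurable => k _; exact: measurable_gt_nat.
pose G := \bigcap_(i in [set` iota 0 K]) ~` cut_block M i.
have mG : measurable G.
  apply: fin_bigcap_measurable => // i _.
  by apply: measurableC; exact: measurable_cut_block.
apply: (@le_trans _ _ (P (G `|` \big[setU/set0]_(i < K) C i))).
  apply: le_measure; rewrite ?inE //.
  - exact: measurable_survival.
  - by apply: measurableU => //; exact: bigsetU_measurable.
  move=> w Sw; apply: contrapT.
  move=> /not_orP[/existsNP[i] /not_implyP[/= iK cut] long].
  apply: Sw; apply: (sub_finite_set _ (finite_II (i.+1 * M))).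
  apply: cut_bounds_activated => [|k]; first by rewrite muln_gt0.
  rewrite leqNgt; apply/negP => kX; apply: long.
  rewrite -bigcup_mkord; exists i; first by move: iK; rewrite mem_iota.
  exists k => //= kM; move/contrapT : cut => /(_ k) /=.
  by rewrite mem_iota /= kM => /(_ isT); lia.
apply: (@le_trans _ _ (P G + P (\big[setU/set0]_(i < K) C i))).
  by apply: measureU2 => //; exact: bigsetU_measurable.
rewrite [P G]prob_no_cut_block leeD2l //.
have PC i : P (C i) <= \sum_(M <= k <oo) (a k)%:E.
  rewrite -[leRHS](_ : \sum_(M <= k <oo)
      P [set w | (k < X (i.+1 * M + k)%N w)%N] = _).
    apply: measure_sigma_subadditive_tail => // k.
    exact: measurable_gt_nat.
  by apply: eq_eseriesr => k _; exact: prob_radius_gt.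
apply: le_trans (Boole_inequality P (fun i _ => mC i)) _.
apply: le_trans (lee_sum _ (fun (i : 'I_K) _ => PC i)) _.
by rewrite sumr_const card_ord mule_natl.
Qed.

Lemma survival_of_finite_mean : (a 0 < 1)%R ->
  \sum_(0 <= k <oo) (a k)%:E < +oo -> P (survival (fun i => X i)) = 0.
Proof.
move=> a01 afin.
have a_ge0 k : 0 <= (a k)%:E by have /andP[] := tail_prob_itv rho k.
set s := \sum_(0 <= k <oo) (a k)%:E in afin.
have s_fin : s \is a fin_num.
  by rewrite ge0_fin_numE //; apply: nneseries_ge0 => k _ _.
pose q : R := expR (- (fine s / (1 - a 0))).
have q_gt0 : (0 < q)%R by exact: expR_gt0.
have q_le M : (q <= \prod_(0 <= k < M) (1 - a k))%R.
  apply: le_trans (expR_le_prod_1B _ a01 (tail_prob_itv rho)).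
  rewrite ler_expR lerN2; apply: ler_wpM2r; first by rewrite invr_ge0; lra.
  by rewrite -lee_fin fineK // -sumEFin; exact: nneseries_lim_ge.
have prod_le1 M : (\prod_(0 <= k < M) (1 - a k) <= 1)%R.
  apply: prodr_ile1 => k _.
  by have := tail_prob_itv rho k; have := tail_prob_le1 rho k; lra.
have q1 : (q <= 1)%R by exact: le_trans (q_le 0%N) (prod_le1 0%N).
have mS := measurable_survival X.
have S_fin : P (survival (fun i => X i)) \is a fin_num.
  by rewrite fin_num_measure.
pose t M : R := fine (\sum_(M <= k <oo) (a k)%:E).
have t_cvg : t M @[M --> \oo] --> (0 : R)%R.
  exact/fine_cvg/(nneseries_tail_cvg afin).
have S_le K : (fine (P (survival (fun i => X i))) <= (1 - q) ^+ K)%R.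
  have cvg_bound :
      ((1 - q) ^+ K + K%:R * t M)%R @[M --> \oo] --> ((1 - q) ^+ K)%R.
    have := cvgD (cvg_cst ((1 - q) ^+ K : R)%R)
      (cvgM (cvg_cst (K%:R : R)) t_cvg).
    by rewrite mulr0 addr0; apply.
  apply: (ler_cvg_to (cvg_cst _) cvg_bound).
  near=> M.
  have M0 : (0 < M)%N by near: M; exists 1%N.
  have tail_fin : \sum_(M <= k <oo) (a k)%:E \is a fin_num.
    rewrite ge0_fin_numE; last by apply: nneseries_ge0 => k _ _.
    apply: le_lt_trans afin; rewrite /s (nneseries_split 0 M) // add0n leeDr //.
    by rewrite sume_ge0.
  rewrite -lee_fin fineK // (le_trans (prob_survival_le K M0)) //.
  rewrite -(fineK tail_fin) -EFinM -EFinD lee_fin lerD2r.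
  by apply: lerXn2r; rewrite ?nnegrE; have := q_le M; have := prod_le1 M; lra.
rewrite -(fineK S_fin); congr EFin; apply/eqP.
rewrite eq_le fine_ge0 ?measure_ge0 // andbT.
apply: (ler_cvg_to (cvg_cst _) (@cvg_expr R (1 - q)%R _)); first last.
  by near=> K; exact: S_le.
by rewrite ger0_norm; lra.
Unshelve. all: by end_near. Qed.

End reverse_firework.

Theorem theorem2p8 (R : realType) (d : measure_display) (T : measurableType d)
    (P : probability T R) (rho : {RV P >-> nat})
    (X : nat -> {RV P >-> nat})
    (hindep : mutually_independent X)
    (hdist : identically_distributed_as X rho)
    (hrho : 0 < P [set w | (rho w < 1)%N] < 1) :
  ('E_P[fun w => (rho w)%:R] = +oo -> P (survival (fun i => X i)) = 1) /\
  ('E_P[fun w => (rho w)%:R] < +oo -> P (survival (fun i => X i)) = 0).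
Proof.
rewrite expectation_tail_prob; split.
  exact: (survival_of_infinite_mean hindep hdist).
apply: survival_of_finite_mean => //.
have /andP[+ _] := hrho.
have -> : [set w | (rho w < 1)%N] = ~` [set w | (0 < rho w)%N].
  by apply/seteqP; split=> w /=; [move=> h | move/negP]; lia.
have mpos := measurable_gt_nat rho 0.
rewrite probability_setC // -(fineK (fin_num_measure P _ mpos)).
by rewrite -EFinB lte_fin subr_gt0.
Qed.
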